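(* Let $\xi\colon E\to B$ be an oriented vector bundle of even rank $n$, let $\mathcal{A}$ be a cdga model of $B$ and let $e\in\mathcal{A}^n$ be a representative of the Euler class. Let $x,y,z$ be cocycles in $\mathcal{A}$ such that the triple Massey product $(w_x,w_y,w_z)$ in $H^*(\mathrm{Th}(\xi);\mathbb{Q})$, computed in the model $\mathcal{A}[e]$, is defined. Then $$e\cdot(x,ey,z)=(ex,y,ez)$$ as subsets of $H^*(B;\mathbb{Q})$, and $(w_x,w_y,w_z)$ is in canonical bijection (via the Thom isomorphism $[a]\mapsto[w_a]$) with this set. This bijection preserves $0$.
   Context: All cdga's are over $\mathbb{Q}$. A cdga model of $B$ is a cdga connected by a string of quasi-isomorphisms to $\mathcal{A}_{PL}(B)$ (Sullivan's piecewise linear forms). $\mathrm{Th}(\xi)$ is the Thom space (disc bundle modulo sphere bundle). $\mathcal{A}[e]$ is the (non-unital) cdga with underlying graded vector space $s^n\mathcal{A}$, $(s^n\mathcal{A})^k=\mathcal{A}^{k-n}$, elements $w_x=s^nx$, differential $d(w_x)=w_{dx}$ and product $w_x\cdot w_y=w_{exy}$; it is a model of $\mathrm{Th}(\xi)$, so that its cohomology is the reduced rational cohomology of $\mathrm{Th}(\xi)$, and $[a]\mapsto[w_a]$ is the Thom isomorphism $H^*(B;\mathbb{Q})\to\tilde H^{*+n}(\mathrm{Th}(\xi);\mathbb{Q})$. For cocycles $a,b,c$ in a cdga with $ab$ and $bc$ exact, the triple Massey product $(a,b,c)$ is the set of cohomology classes $\{[(-1)^{|a|}a\mu-\lambda c]\mid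 d\lambda=ab,\ d\mu=bc\}$; it is defined when $ab$ and $bc$ are exact. $e\cdot S=\{e\cdot s\mid s\in S\}$ for a subset $S$ of cohomology. *)

(* Defs.v *)
From HB Require Import structures.
From mathcomp Require Import all_boot all_order all_algebra.
From mathcomp Require Import generic_quotient ring_quotient.
From mathcomp Require Import mathcomp_extra boolp classical_sets functions.
From mathcomp Require Import reals topology normedtype.

Set Implicit Arguments.
Unset Strict Implicit.
Unset Printing Implicit Defensive.
Import Order.TTheory GRing.Theory Num.Theory.
Import numFieldNormedType.Exports.
Local Open Scope classical_set_scope.
Local Open Scope ring_scope.
Local Open Scope quotient_scope.

(* A grading on V is given by the projections [pr k] onto its degree-k parts
   V^k = {v | pr k v = v}: together with linearity the two fields say exactly
   that V is the direct sum of the V^k, k in Z. *)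
Record grading (V : lmodType rat) := Grading {
  pr :> int -> V -> V;
  pr_linear : forall k, linear (pr k);
  pr_pr : forall k j v, pr k (pr j v) = if k == j then pr j v else 0;
  pr_sum : forall v, exists2 s : seq int, uniq s & v = \sum_(k <- s) pr k v
}.

Section GradingSum.
Variables (V : lmodType rat) (G : grading V).

HB.instance Definition _ k := GRing.isLinear.Build rat V V *:%R (G k)
  (pr_linear G k).

Lemma grading_sum (s : seq int) (v : V) : uniq s ->
  (forall k, k \notin s -> G k v = 0) -> v = \sum_(k <- s) G k v.
Proof.
move=> us sP; have [r ur vr] := pr_sum G v.
have rP k : k \notin r -> G k v = 0.
  move=> kr; rewrite vr linear_sum big1_seq //= => j /= jr.
  by rewrite pr_pr; case: eqP kr => // ->; rewrite jr.
transitivity (\sum_(k <- r | k \in s) G k v).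
  by rewrite {1}vr (bigID (mem s)) /= [X in _ + X]big1 ?addr0 // => k /sP.
transitivity (\sum_(k <- s | k \in r) G k v); last first.
  by rewrite [RHS](bigID (mem r)) /= [X in _ + X]big1 ?addr0 // => k /rP.
rewrite -[LHS]big_filter -[RHS]big_filter.
apply: perm_big; apply: uniq_perm; rewrite ?filter_uniq // => k.
by rewrite !mem_filter andbC.
Qed.

End GradingSum.

(* Possibly non-unital commutative differential graded algebras over Q.
   Products and differentials are those of the total space. *)
Record nucdga := NUCdga {
  car :> lmodType rat;
  gr : grading car;
  amul : car -> car -> car;
  cdiff : car -> car;
  mul_linearl : forall y, linear (fun x => amul x y);
  mul_linearr : forall x, linear (amul x);
  mulA : associative amul;
  mul_hom : forall i j x y,
    gr i x = x -> gr j y = y -> gr (i + j) (amul x y) = amul x y;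
  mul_comm : forall i j x y, gr i x = x -> gr j y = y ->
    amul x y = ((-1) ^ (i * j) : rat) *: amul y x;
  diff_linear : linear cdiff;
  diff_hom : forall i x, gr i x = x -> gr (i + 1) (cdiff x) = cdiff x;
  diff_diff : forall x, cdiff (cdiff x) = 0;
  diff_mul : forall i x y, gr i x = x ->
    cdiff (amul x y) = amul (cdiff x) y + ((-1) ^ i : rat) *: amul x (cdiff y)
}.

Definition homog (A : nucdga) (k : int) (x : A) : Prop := gr A k x = x.

Record cdga := Cdga {
  base :> nucdga;
  aone : base;
  hom_one : homog 0 aone;
  mul1x : left_id aone (@amul base);
  mulx1 : right_id aone (@amul base)
}.

Section Basics.
Variable A : nucdga.
Implicit Types x y : A.

HB.instance Definition _ := GRing.isLinear.Build rat A A *:%R (@cdiff A)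
  (@diff_linear A).
HB.instance Definition _ x := GRing.isLinear.Build rat A A *:%R (@amul A x)
  (@mul_linearr A x).

Lemma mulDl x x' y : amul (x + x') y = amul x y + amul x' y.
Proof. by have := @mul_linearl A y 1 x x'; rewrite !scale1r. Qed.

Lemma mul0x y : amul (0 : A) y = 0.
Proof.
by have := mulDl (0 : A) 0 y; rewrite addr0 => /esym/(canRL (addrK _)); rewrite subrr.
Qed.

Lemma mulZl a x y : amul (a *: x) y = a *: amul x y.
Proof. by have := @mul_linearl A y a x 0; rewrite mul0x !addr0. Qed.

Lemma mulBl x x' y : amul (x - x') y = amul x y - amul x' y.
Proof. by rewrite mulDl -[- x']scaleN1r mulZl scaleN1r. Qed.

Lemma mul_suml I (r : seq I) (F : I -> A) y :
  amul (\sum_(i <- r) F i) y = \sum_(i <- r) amul (F i) y.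
Proof. by elim/big_rec2: _ => [|i u v _ <-]; rewrite ?mul0x ?mulDl. Qed.

Lemma pr_hom k x : homog k (gr A k x).
Proof. by rewrite /homog pr_pr eqxx. Qed.

Lemma hom_pr k j x : homog j x -> gr A k x = if k == j then x else 0.
Proof. by move=> xj; rewrite -{1}xj pr_pr xj. Qed.

Lemma mul_support (S S' : seq int) x y :
  (forall i, i \notin S -> gr A i x = 0) ->
  (forall j, j \notin S' -> gr A j y = 0) ->
  forall k, k \notin [seq i + j | i <- S, j <- S'] -> gr A k (amul x y) = 0.
Proof.
move=> xS yS' k kS; have [r _ xr] := pr_sum (gr A) x.
have [r' _ yr'] := pr_sum (gr A) y.
rewrite xr yr' mul_suml linear_sum big1 //= => i _.
rewrite linear_sum linear_sum big1 //= => j _.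
rewrite (hom_pr _ (mul_hom (pr_hom i _) (pr_hom j _))); case: eqP => // kij.
have [iS|iS] := boolP (i \in S); last by rewrite xS // mul0x.
have [jS|jS] := boolP (j \in S'); last by rewrite yS' // linear0.
by move: kS; rewrite kij allpairs_f.
Qed.

Lemma diff_support (S : seq int) x : (forall i, i \notin S -> gr A i x = 0) ->
  forall k, k \notin [seq i + 1 | i <- S] -> gr A k (cdiff x) = 0.
Proof.
move=> xS k kS; have [r _ xr] := pr_sum (gr A) x.
rewrite xr linear_sum linear_sum big1 //= => i _.
rewrite (hom_pr _ (diff_hom (pr_hom i _))); case: eqP => // ki.
have [iS|iS] := boolP (i \in S); last by rewrite xS // linear0.
by move: kS; rewrite ki (map_f (fun i => i + 1)).
Qed.

End Basics.

Section Cohomology.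
Variable A : nucdga.

Definition cocycle_pred : {pred A} := fun x => cdiff x == 0.

Lemma cocycle_closed : submod_closed cocycle_pred.
Proof.
split=> [|a x y /eqP x0 /eqP y0]; first by rewrite unfold_in linear0.
by rewrite unfold_in /cocycle_pred linearP /= x0 y0 scaler0 addr0.
Qed.
HB.instance Definition _ := GRing.isSubmodClosed.Build rat A cocycle_pred
  cocycle_closed.

Record cocycle := Cocycle { cval :> A; cvalP : cval \in cocycle_pred }.
HB.instance Definition _ := [isSub for cval].
HB.instance Definition _ := [Choice of cocycle by <:].
HB.instance Definition _ := [SubChoice_isSubLmodule of cocycle by <:].

Lemma diff_cocycle (x : cocycle) : cdiff (x : A) = 0.
Proof. exact/eqP/(cvalP x). Qed.

Definition is_exact (x : A) : Prop := exists y, cdiff y = x.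

Definition coboundary : {pred cocycle} := fun x => `[< is_exact x >].

Lemma coboundary_closed : zmod_closed coboundary.
Proof.
split=> [|x y /asboolP[u ux] /asboolP[v vy]].
  by apply/asboolP; exists 0; rewrite linear0.
by apply/asboolP; exists (u - v); rewrite linearB /= ux vy.
Qed.
HB.instance Definition _ := GRing.isZmodClosed.Build cocycle coboundary
  coboundary_closed.

(* The total cohomology, i.e. the direct sum of the H^k. *)
Definition cohomology : zmodType := Quotient.quot coboundary.
Definition cls (x : cocycle) : cohomology := \pi_(Quotient.quot coboundary) x.

Lemma cls_eq (x y : cocycle) : cls x = cls y <-> is_exact (x - y : A).
Proof.
split=> [/eqP|xy]; first by rewrite -Quotient.idealrBE => /asboolP.
by apply/eqP; rewrite -Quotient.idealrBE; apply/asboolP.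
Qed.

Definition rep (h : cohomology) : cocycle := repr (h : Quotient.quot coboundary).

Lemma rep_cls x : is_exact (rep (cls x) - x : A).
Proof. by apply/cls_eq; rewrite /cls /rep reprK. Qed.

Lemma rep_K h : cls (rep h) = h.
Proof. exact: (@reprK _ (Quotient.quot coboundary)). Qed.

End Cohomology.

Section CohomologyRing.
Variable A : nucdga.

(* Cocycles need not be homogeneous: x' is x with signs (-1)^k in degrees k. *)
Lemma diff_mul_closed (x : A) : cdiff x = 0 -> exists x' : A,
  forall y, cdiff (amul x y) = amul x' (cdiff y) /\
            cdiff (amul x' y) = amul x (cdiff y).
Proof.
move=> x0; have [s us xs] := pr_sum (gr A) x.
have dpr k : cdiff (gr A k x) = 0.
  have ddec : \sum_(j <- s) cdiff (gr A j x) = 0.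
    by rewrite -linear_sum /= -xs.
  have [ks|ks] := boolP (k \in s); last first.
    suff -> : gr A k x = 0 by rewrite linear0.
    rewrite xs linear_sum big1_seq //= => j /= js.
    by rewrite pr_pr; case: eqP ks => // ->; rewrite js.
  have := congr1 (gr A (k + 1)) ddec.
  rewrite linear0 linear_sum (bigD1_seq k) //= (diff_hom (pr_hom _ _)) big1 ?addr0 //.
  move=> j jk; rewrite -(diff_hom (pr_hom j _)) pr_pr.
  by rewrite (inj_eq (addIr _)) eq_sym (negbTE jk).
exists (\sum_(k <- s) ((-1) ^ k : rat) *: gr A k x) => y; split.
  rewrite {1}xs !mul_suml linear_sum /=; apply: eq_bigr => k _.
  by rewrite (diff_mul _ (pr_hom k _)) dpr mul0x add0r mulZl.
rewrite {2}xs !mul_suml linear_sum /=; apply: eq_bigr => k _.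
rewrite mulZl linearZ /= (diff_mul _ (pr_hom k _)) dpr mul0x add0r scalerA.
by rewrite -expfzMl mulrNN mulr1 exp1rz scale1r.
Qed.

Lemma diff_mul_cocycle (u : A) (y : cocycle A) :
  cdiff (amul u (y : A)) = amul (cdiff u) y.
Proof.
have [s us ->] := pr_sum (gr A) u.
rewrite mul_suml !linear_sum mul_suml /=; apply: eq_bigr => k _.
by rewrite (diff_mul _ (pr_hom k _)) diff_cocycle linear0 scaler0 addr0.
Qed.

Lemma mul_cocycle_subproof (x y : cocycle A) :
  amul (x : A) y \in @cocycle_pred A.
Proof.
by rewrite unfold_in /cocycle_pred diff_mul_cocycle diff_cocycle mul0x.
Qed.

Definition cmul (x y : cocycle A) : cocycle A := Cocycle (mul_cocycle_subproof x y).
Definition hmul (h k : cohomology A) : cohomology A := cls (cmul (rep h) (rep k)).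

Lemma hmulE x y : hmul (cls x) (cls y) = cls (cmul x y).
Proof.
apply/cls_eq; have [u xu] := rep_cls x; have [v yv] := rep_cls y.
have [x' x'P] := diff_mul_closed (diff_cocycle (rep (cls x))).
exists (amul x' v + amul u (y : A)).
rewrite linearD /= (x'P v).2 diff_mul_cocycle xu yv /=.
by rewrite linearB mulBl /= addrA subrK.
Qed.

End CohomologyRing.

(* [massey p q r a b c] is the triple Massey product of cocycles a, b, c of
   degrees p, q, r; the cochains l and m are homogeneous, of the degrees forced
   by dl = ab and dm = bc. *)
Definition massey_defined (A : nucdga) (a b c : cocycle A) : Prop :=
  is_exact (amul (a : A) b) /\ is_exact (amul (b : A) c).

Definition massey (A : nucdga) (p q r : int) (a b c : cocycle A) :
    set (cohomology A) :=
  [set h | exists l m : A, exists v : cocycle A,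
    [/\ homog (p + q - 1) l /\ cdiff l = amul (a : A) b,
        homog (q + r - 1) m /\ cdiff m = amul (b : A) c,
        v = ((-1) ^ p : rat) *: amul (a : A) m - amul l (c : A) :> A
      & h = cls v]].

(* The cdga A[e]: the suspension s^n A has the same total space as A, with
   (s^n A)^k = A^(k - n), and w_x = s^n x is the identity of total spaces. *)
Section ThomCdga.
Variables (A : cdga) (n : nat) (n_even : ~~ odd n).
Variables (e : cocycle A) (e_n : homog n%:Z (e : A)).

Lemma shift_grading_subproof1 k : linear (gr A (k - n%:Z)).
Proof. exact: pr_linear. Qed.
Lemma shift_grading_subproof2 k j v :
  gr A (k - n%:Z) (gr A (j - n%:Z) v) = if k == j then gr A (j - n%:Z) v else 0.
Proof. by rewrite pr_pr (inj_eq (addIr _)). Qed.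
Lemma shift_grading_subproof3 v : exists2 s : seq int,
  uniq s & v = \sum_(k <- s) gr A (k - n%:Z) v.
Proof.
have [s us vs] := pr_sum (gr A) v.
exists [seq k + n%:Z | k <- s]; first by rewrite map_inj_uniq //; apply: addIr.
by rewrite big_map [LHS]vs; apply: eq_bigr => k _; rewrite addrK.
Qed.
Definition shift_grading : grading A := Grading shift_grading_subproof1
  shift_grading_subproof2 shift_grading_subproof3.

Definition thom_mul (x y : A) : A := amul (amul (e : A) x) y.

Lemma sign_n (i : int) : ((-1) ^ (n%:Z * i) : rat) = 1.
Proof. by rewrite -exprz_exp -exprnP -signr_odd (negbTE n_even) expr0 exp1rz. Qed.

Lemma mul_ex (x : A) : amul (e : A) x = amul x e.
Proof.
have [s us ->] := pr_sum (gr A) x.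
rewrite mul_suml linear_sum /=; apply: eq_bigr => k _.
by rewrite (mul_comm e_n (pr_hom k x)) sign_n scale1r.
Qed.

Lemma thom_mul_linearl y : linear (thom_mul^~ y).
Proof. by move=> a u v; rewrite /thom_mul linearP /= mul_linearl. Qed.
Lemma thom_mul_linearr x : linear (thom_mul x).
Proof. exact: mul_linearr. Qed.
Lemma thom_mulA : associative thom_mul.
Proof. by move=> x y z; rewrite /thom_mul !mulA -[amul (amul _ x) e]mul_ex !mulA. Qed.
Lemma thom_mul_hom i j x y : gr A (i - n%:Z) x = x -> gr A (j - n%:Z) y = y ->
  gr A (i + j - n%:Z) (thom_mul x y) = thom_mul x y.
Proof.
move=> xi yj; have -> : i + j - n%:Z = n%:Z + (i - n%:Z) + (j - n%:Z).
  by rewrite (addrC n%:Z) subrK addrA.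
by apply: mul_hom => //; apply: mul_hom.
Qed.
Lemma thom_mul_comm i j x y : gr A (i - n%:Z) x = x -> gr A (j - n%:Z) y = y ->
  thom_mul x y = ((-1) ^ (i * j) : rat) *: thom_mul y x.
Proof.
move=> xi yj; rewrite /thom_mul -!mulA (mul_comm xi yj) linearZ /=; congr (_ *: _).
have u1 : (-1 : rat) \is a GRing.unit by rewrite unitrN1.
move: (i - n%:Z) (subrK n%:Z i) (j - n%:Z) (subrK n%:Z j) => i' <- j' <-.
by rewrite mulrDl mulrDr expfzDr // expfzDr // (mulrC i' n%:Z) !sign_n !mulr1.
Qed.
Lemma thom_diff_hom i x : gr A (i - n%:Z) x = x ->
  gr A (i + 1 - n%:Z) (cdiff x) = cdiff x.
Proof. by move=> xi; rewrite addrAC; apply: diff_hom. Qed.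
Lemma thom_diff_mul i x y : gr A (i - n%:Z) x = x ->
  cdiff (thom_mul x y) =
    thom_mul (cdiff x) y + ((-1) ^ i : rat) *: thom_mul x (cdiff y).
Proof.
move=> xi; rewrite /thom_mul (diff_mul _ (mul_hom e_n xi)) (diff_mul _ e_n).
rewrite diff_cocycle mul0x add0r.
have -> : ((-1) ^ n%:Z : rat) = 1 by rewrite -[n%:Z]mulr1 sign_n.
by rewrite scale1r (addrC n%:Z) subrK.
Qed.

Definition thom_cdga : nucdga :=
  @NUCdga A shift_grading thom_mul (@cdiff A) thom_mul_linearl thom_mul_linearr
    thom_mulA thom_mul_hom thom_mul_comm (@diff_linear A) thom_diff_hom
    (@diff_diff A) thom_diff_mul.

Definition w (x : A) : thom_cdga := x.

Lemma w_cocycle_subproof (x : cocycle A) : w x \in @cocycle_pred thom_cdga.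
Proof. exact: (cvalP x). Qed.
Definition wc (x : cocycle A) : cocycle thom_cdga := Cocycle (w_cocycle_subproof x).

Definition thom_iso (h : cohomology A) : cohomology thom_cdga := cls (wc (rep h)).

Lemma thom_isoE x : thom_iso (cls x) = cls (wc x).
Proof. by apply/cls_eq; have [y xy] := rep_cls x; exists y. Qed.

Lemma w_hom k x : homog k x -> homog (k + n%:Z) (w x).
Proof. by rewrite /homog /= addrK. Qed.

End ThomCdga.

Record cdga_mor (A C : cdga) := CdgaMor {
  mor :> A -> C;
  mor_linear : linear mor;
  mor_pr : forall k x, mor (gr A k x) = gr C k (mor x);
  mor_mul : {morph mor : x y / amul x y};
  mor_one : mor (aone A) = aone C;
  mor_diff : {morph mor : x / cdiff x}
}.

Section InducedMap.
Variables (A C : cdga) (f : cdga_mor A C).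
HB.instance Definition _ := GRing.isLinear.Build rat A C *:%R f (mor_linear f).

Lemma mor_cocycle_subproof (x : cocycle A) : f x \in @cocycle_pred C.
Proof. by rewrite unfold_in /cocycle_pred -mor_diff diff_cocycle linear0. Qed.
Definition cmor (x : cocycle A) : cocycle C := Cocycle (mor_cocycle_subproof x).
Definition hmor (h : cohomology A) : cohomology C := cls (cmor (rep h)).

Lemma hmorE x : hmor (cls x) = cls (cmor x).
Proof.
apply/cls_eq; have [y xy] := rep_cls x; exists (f y).
by rewrite -mor_diff xy /= linearB.
Qed.

Definition quasi_iso : Prop := bijective hmor.
End InducedMap.

(* A string of quasi-isomorphisms from A to C, with arrows in either direction,
   and the isomorphism from H(A) to H(C) that it induces. *)
Inductive quasi_iso_string : cdga -> cdga -> Type :=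
| string_nil A : quasi_iso_string A A
| string_fwd A B C (f : cdga_mor A B) :
    quasi_iso f -> quasi_iso_string B C -> quasi_iso_string A C
| string_bwd A B C (f : cdga_mor B A) :
    quasi_iso f -> quasi_iso_string B C -> quasi_iso_string A C.

Fixpoint string_iso (A C : cdga) (s : quasi_iso_string A C) :
    cohomology A -> cohomology C :=
  match s in quasi_iso_string A C return cohomology A -> cohomology C with
  | string_nil A => id
  | string_fwd A B C f _ s' => fun h => string_iso s' (hmor f h)
  | string_bwd A B C f _ s' => fun h =>
      string_iso s' (xget (0 : cohomology B) [set h' | hmor f h' = h])
  end.

(* Polynomial forms on the m-simplex: the cdga generated by t_0, ..., t_m in
   degree 0 subject to t_0 + ... + t_m = 1.  It is constructed as the set of
   terms in the operations of a cdga (projections included), two terms being identified when they take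
   the same value in every cdga C at all c_0, ..., c_m in C^0 of sum 1. *)
Inductive pterm (m : nat) :=
| tvar of 'I_m.+1
| tzero
| tone
| tadd of pterm m & pterm m
| tscale of rat & pterm m
| tpr of int & pterm m
| tmul of pterm m & pterm m
| tdiff of pterm m.
Arguments tzero {m}.
Arguments tone {m}.

Fixpoint peval (m : nat) (C : cdga) (c : 'I_m.+1 -> C) (t : pterm m) : C :=
  match t with
  | tvar i => c i
  | tzero => 0
  | tone => aone C
  | tadd t u => peval c t + peval c u
  | tscale a t => a *: peval c t
  | tpr k t => gr C k (peval c t)
  | tmul t u => amul (peval c t) (peval c u)
  | tdiff t => cdiff (peval c t)
  end.

Definition simplex_point (m : nat) (C : cdga) (c : 'I_m.+1 -> C) : Prop :=
  (forall i, homog 0 (c i)) /\ \sum_i c i = aone C.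

Definition term_eq (m : nat) (t u : pterm m) : Prop :=
  forall (C : cdga) (c : 'I_m.+1 -> C), simplex_point c -> peval c t = peval c u.

Section PolynomialForms.
Variable m : nat.

HB.instance Definition _ := gen_eqMixin (pterm m).
HB.instance Definition _ := gen_choiceMixin (pterm m).

Definition term_eqb : rel (pterm m) := fun t u => `[< term_eq t u >].

Lemma term_eqb_equiv : equiv_class_of term_eqb.
Proof.
split=> [t|t u|u t v].
- by apply/asboolP.
- by apply/asboolP/asboolP=> tu C c cP; rewrite tu.
- move=> /asboolP tu /asboolP uv; apply/asboolP => C c cP.
  by rewrite tu // uv.
Qed.
Canonical term_equiv := EquivRelPack term_eqb_equiv.
Canonical term_encModRel := defaultEncModRel term_eqb.

Definition pform := {eq_quot term_eqb}.
HB.instance Definition _ := Choice.on pform.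

Definition fpi (t : pterm m) : pform := \pi_pform t.
Definition frep (x : pform) : pterm m := repr x.

Lemma fpi_eq t u : fpi t = fpi u <-> term_eq t u.
Proof. by split=> [/eqmodP/asboolP|tu] //; apply/eqmodP/asboolP. Qed.

Lemma frepK x : fpi (frep x) = x.
Proof. exact: reprK. Qed.

Section Eval.
Variables (C : cdga) (c : 'I_m.+1 -> C).
Definition feval (x : pform) : C := peval c (frep x).
Lemma feval_pi t : simplex_point c -> feval (fpi t) = peval c t.
Proof. by move=> cP; have /fpi_eq/(_ C c cP) := frepK (fpi t). Qed.
End Eval.

Lemma form_ext x y :
  (forall (C : cdga) (c : 'I_m.+1 -> C), simplex_point c -> feval c x = feval c y) ->
  x = y.
Proof. by move=> xy; rewrite -(frepK x) -(frepK y); apply/fpi_eq. Qed.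

Definition fzero : pform := fpi tzero.
Definition fadd (x y : pform) : pform := fpi (tadd (frep x) (frep y)).
Definition fscale a (x : pform) : pform := fpi (tscale a (frep x)).
Definition fopp (x : pform) : pform := fscale (-1) x.
Definition fpr k (x : pform) : pform := fpi (tpr k (frep x)).
Definition fmul (x y : pform) : pform := fpi (tmul (frep x) (frep y)).
Definition fdiff (x : pform) : pform := fpi (tdiff (frep x)).
Definition fone : pform := fpi tone.
Definition fvar i : pform := fpi (tvar i).

Section EvalE.
Variables (C : cdga) (c : 'I_m.+1 -> C) (cP : simplex_point c).
Lemma feval0 : feval c fzero = 0. Proof. exact: feval_pi. Qed.
Lemma feval1 : feval c fone = aone C. Proof. exact: feval_pi. Qed.
Lemma fevalX i : feval c (fvar i) = c i. Proof. exact: feval_pi. Qed.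
Lemma fevalD x y : feval c (fadd x y) = feval c x + feval c y.
Proof. exact: feval_pi. Qed.
Lemma fevalZ a x : feval c (fscale a x) = a *: feval c x.
Proof. exact: feval_pi. Qed.
Lemma fevalN x : feval c (fopp x) = - feval c x.
Proof. by rewrite fevalZ scaleN1r. Qed.
Lemma feval_pr k x : feval c (fpr k x) = gr C k (feval c x).
Proof. exact: feval_pi. Qed.
Lemma feval_mul x y : feval c (fmul x y) = amul (feval c x) (feval c y).
Proof. exact: feval_pi. Qed.
Lemma feval_diff x : feval c (fdiff x) = cdiff (feval c x).
Proof. exact: feval_pi. Qed.
Definition fevalE := (feval0, feval1, fevalX, fevalD, fevalZ, fevalN, feval_pr,
  feval_mul, feval_diff).
End EvalE.

Lemma faddA : associative fadd.
Proof. by move=> x y z; apply: form_ext => C c cP; rewrite !fevalE // addrA. Qed.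
Lemma faddC : commutative fadd.
Proof. by move=> x y; apply: form_ext => C c cP; rewrite !fevalE // addrC. Qed.
Lemma fadd0 : left_id fzero fadd.
Proof. by move=> x; apply: form_ext => C c cP; rewrite !fevalE // add0r. Qed.
Lemma faddN : left_inverse fzero fopp fadd.
Proof. by move=> x; apply: form_ext => C c cP; rewrite !fevalE // addNr. Qed.
HB.instance Definition _ := GRing.isZmodule.Build pform faddA faddC fadd0 faddN.

Lemma fscaleA a b x : fscale a (fscale b x) = fscale (a * b) x.
Proof. by apply: form_ext => C c cP; rewrite !fevalE // scalerA. Qed.
Lemma fscale1 : left_id 1 fscale.
Proof. by move=> x; apply: form_ext => C c cP; rewrite !fevalE // scale1r. Qed.
Lemma fscaleDr : right_distributive fscale +%R.
Proof. by move=> a x y; apply: form_ext => C c cP; rewrite !fevalE // scalerDr. Qed.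
Lemma fscaleDl x : {morph fscale^~ x : a b / a + b}.
Proof. by move=> a b; apply: form_ext => C c cP; rewrite !fevalE // scalerDl. Qed.
HB.instance Definition _ := GRing.Zmodule_isLmodule.Build rat pform
  fscaleA fscale1 fscaleDr fscaleDl.

Lemma feval_linear (C : cdga) (c : 'I_m.+1 -> C) : simplex_point c ->
  linear (feval c).
Proof. by move=> cP a x y; rewrite fevalD // fevalZ. Qed.

Lemma feval_sum (C : cdga) (c : 'I_m.+1 -> C) (cP : simplex_point c)
    I (r : seq I) (F : I -> pform) :
  feval c (\sum_(i <- r) F i) = \sum_(i <- r) feval c (F i).
Proof.
elim/big_rec2: _ => [|i u v _ <-]; first exact: feval0.
by rewrite fevalD.
Qed.

(* a finite set of degrees supporting the values of a term in all cdgas *)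
Lemma term_support (t : pterm m) : exists s : seq int,
  forall (C : cdga) (c : 'I_m.+1 -> C), simplex_point c ->
  forall k, k \notin s -> gr C k (peval c t) = 0.
Proof.
elim: t => [i|||t [s sP] u [s' s'P]|a t [s sP]|j t _|t [s sP] u [s' s'P]|t [s sP]].
- exists [:: 0] => C c [c0 _] k; rewrite inE => /negbTE k0.
  by rewrite /= (hom_pr _ (c0 i)) k0.
- by exists [::] => C c cP k _; rewrite /= linear0.
- exists [:: 0] => C c _ k; rewrite inE => /negbTE k0.
  by rewrite /= (hom_pr _ (hom_one C)) k0.
- exists (s ++ s') => C c cP k; rewrite mem_cat negb_or => /andP[ks ks'].
  by rewrite /= linearD /= (sP C c) // (s'P C c) // addr0.
- exists s => C c cP k ks; by rewrite /= linearZ /= (sP C c) // scaler0.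
- exists [:: j] => C c cP k; rewrite inE => /negbTE kj.
  by rewrite /= pr_pr kj.
- exists [seq i + j | i <- s, j <- s'] => C c cP.
  by apply: mul_support; [apply: sP|apply: s'P].
- by exists [seq i + 1 | i <- s] => C c cP; apply: diff_support; apply: sP.
Qed.

End PolynomialForms.
Section FormCdga.
Variable m : nat.
Implicit Types x y : pform m.

Lemma fpr_linear k : linear (@fpr m k).
Proof.
by move=> a x y; apply: form_ext => C c cP; rewrite !(fevalE cP, feval_linear cP) linearP.
Qed.

Lemma fpr_pr k j x : fpr k (fpr j x) = if k == j then fpr j x else 0.
Proof.
apply: form_ext => C c cP; rewrite !fevalE // pr_pr.
by case: eqP => _; rewrite fevalE.
Qed.

Lemma fpr_sum x : exists2 s : seq int, uniq s & x = \sum_(k <- s) fpr k x.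
Proof.
have [s sP] := term_support (frep x); exists (undup s); first exact: undup_uniq.
apply: form_ext => C c cP; rewrite feval_sum //.
rewrite [LHS](grading_sum (G := gr C) (undup_uniq s)).
  by apply: eq_bigr => k _; rewrite fevalE.
by move=> k; rewrite mem_undup => /sP; apply.
Qed.

Definition form_grading : grading (pform m) := Grading fpr_linear fpr_pr fpr_sum.

Lemma feval_hom k x (C : cdga) (c : 'I_m.+1 -> C) : simplex_point c ->
  fpr k x = x -> homog k (feval c x).
Proof. by move=> cP kx; rewrite /homog -feval_pr // kx. Qed.

Lemma fmul_linearl y : linear (fun x => fmul x y).
Proof.
move=> a x x'; apply: form_ext => C c cP.
by rewrite !(fevalE cP, feval_linear cP) mulDl mulZl.
Qed.
Lemma fmul_linearr x : linear (fmul x).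
Proof.
move=> a y y'; apply: form_ext => C c cP.
by rewrite !(fevalE cP, feval_linear cP) linearP.
Qed.
Lemma fmulA : associative (@fmul m).
Proof. by move=> x y z; apply: form_ext => C c cP; rewrite !fevalE // mulA. Qed.
Lemma fmul_hom i j x y : form_grading i x = x -> form_grading j y = y ->
  form_grading (i + j) (fmul x y) = fmul x y.
Proof.
move=> xi yj; apply: form_ext => C c cP; rewrite !fevalE //.
by apply: mul_hom; apply: feval_hom.
Qed.
Lemma fmul_comm i j x y : form_grading i x = x -> form_grading j y = y ->
  fmul x y = ((-1) ^ (i * j) : rat) *: fmul y x.
Proof.
move=> xi yj; apply: form_ext => C c cP; rewrite !fevalE //.
by apply: mul_comm; apply: feval_hom.
Qed.
Lemma fdiff_linear : linear (@fdiff m).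
Proof.
move=> a x y; apply: form_ext => C c cP.
by rewrite !(fevalE cP, feval_linear cP) linearP.
Qed.
Lemma fdiff_hom i x : form_grading i x = x ->
  form_grading (i + 1) (fdiff x) = fdiff x.
Proof.
move=> xi; apply: form_ext => C c cP; rewrite !fevalE //.
by apply: diff_hom; apply: feval_hom.
Qed.
Lemma fdiff_diff x : fdiff (fdiff x) = 0.
Proof. by apply: form_ext => C c cP; rewrite !fevalE // diff_diff. Qed.
Lemma fdiff_mul i x y : form_grading i x = x ->
  fdiff (fmul x y) = fmul (fdiff x) y + ((-1) ^ i : rat) *: fmul x (fdiff y).
Proof.
move=> xi; apply: form_ext => C c cP; rewrite !fevalE //.
by apply: diff_mul; apply: feval_hom.
Qed.

Definition form_nucdga : nucdga :=
  @NUCdga (pform m) form_grading (@fmul m) (@fdiff m) fmul_linearl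
    fmul_linearr fmulA fmul_hom fmul_comm fdiff_linear fdiff_hom fdiff_diff
    fdiff_mul.

Lemma fhom_one : homog 0 (fone m : form_nucdga).
Proof.
by apply: form_ext => C c cP; rewrite !fevalE //; apply: hom_one.
Qed.
Lemma fmul1x : left_id (fone m) (@fmul m).
Proof. by move=> x; apply: form_ext => C c cP; rewrite !fevalE // mul1x. Qed.
Lemma fmulx1 : right_id (fone m) (@fmul m).
Proof. by move=> x; apply: form_ext => C c cP; rewrite !fevalE // mulx1. Qed.

Definition form_cdga : cdga := @Cdga form_nucdga (fone m) fhom_one fmul1x fmulx1.

Definition tcoord (i : 'I_m.+1) : form_cdga := fvar i.

Lemma tcoord_simplex_point : simplex_point tcoord.
Proof.
split=> [i|]; apply: form_ext => C c cP; case: (cP) => c0 c1.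
  by rewrite !fevalE //; apply: c0.
rewrite fevalE // -c1 feval_sum //; apply: eq_bigr => i _; exact: fevalX.
Qed.

End FormCdga.

(* A map a of vertices induces the affine map of simplices
   s |-> (\sum_(j | a j = i) s_j)_i, along which forms are pulled back. *)
Section Pullback.
Variables (k m : nat) (a : 'I_k.+1 -> 'I_m.+1).

Definition pull_coord (i : 'I_m.+1) : form_cdga k := \sum_(j | a j == i) tcoord j.

Lemma pull_coordP : simplex_point pull_coord.
Proof.
have [t0 t1] := tcoord_simplex_point k; split=> [i|].
  rewrite /homog linear_sum; apply: eq_bigr => j _; exact: t0.
by rewrite -t1 [RHS](partition_big a xpredT).
Qed.

Definition pull (x : form_cdga m) : form_cdga k := feval pull_coord x.

Lemma pull_linear : linear pull.
Proof. exact: (feval_linear pull_coordP). Qed.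
HB.instance Definition _ := GRing.isLinear.Build rat (form_cdga m) (form_cdga k)
  *:%R pull pull_linear.

End Pullback.

Section SingularSimplices.
Variable R : realType.

Definition simplex (m : nat) : set 'rV[R]_m.+1 :=
  [set s | (forall i, 0 <= s 0 i) /\ \sum_i s 0 i = 1].

Definition push (k m : nat) (a : 'I_k.+1 -> 'I_m.+1) (s : 'rV[R]_k.+1) :
  'rV[R]_m.+1 := \row_i \sum_(j | a j == i) s 0 j.

(* Only the values of a singular simplex on [simplex m] are meaningful. *)
Record singular (X : topologicalType) (m : nat) := Singular {
  sing :> 'rV[R]_m.+1 -> X;
  sing_cont : {within @simplex m, continuous sing}
}.

End SingularSimplices.
Arguments simplex {R} m _.

(* Sullivan's A_PL(X): families of polynomial forms on the singular simplices
   of X compatible with the simplicial operators.  Taking a = id, compatibility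
   includes independence from the values of a simplex off [simplex m].
   [apl_bounded] makes the total space the direct sum of the A_PL^k(X). *)
Section APL.
Variables (R : realType) (X : topologicalType).

Definition apl_compat (f : forall m, singular R X m -> form_cdga m) : Prop :=
  forall k m (a : 'I_k.+1 -> 'I_m.+1) (t : singular R X k) (s : singular R X m),
    {homo a : i j / (i <= j)%N} ->
    (forall p, simplex k p -> t p = s (push a p)) ->
    f k t = pull a (f m s).

Definition apl_bounded (f : forall m, singular R X m -> form_cdga m) : Prop :=
  exists S : seq int, forall m (s : singular R X m) k,
    k \notin S -> gr (form_cdga m) k (f m s) = 0.

Record apl := Apl {
  apl_form :> forall m, singular R X m -> form_cdga m;
  apl_formP : apl_compat apl_form;
  apl_formB : apl_bounded apl_form
}.

Lemma apl_ext (f g : apl) : (forall m s, f m s = g m s) -> f = g.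
Proof.
case: f g => [f fP fB] [g gP gB] /= fg.
have fgE : f = g
  by apply: functional_extensionality_dep => m; apply/funext => s; apply: fg.
by subst g; rewrite (Prop_irrelevance fP gP) (Prop_irrelevance fB gB).
Qed.

HB.instance Definition _ := gen_eqMixin apl.
HB.instance Definition _ := gen_choiceMixin apl.

Definition apl_zero : apl.
Proof.
exists (fun m _ => 0); first by move=> k m a t s _ _; rewrite linear0.
by exists [::] => *; rewrite linear0.
Defined.

Definition apl_one : apl.
Proof.
exists (fun m _ => aone (form_cdga m)).
  by move=> k m a t s _ _; rewrite /pull (feval1 (pull_coordP a)).
exists [:: 0] => m s k; rewrite inE => /negbTE k0.
by rewrite (hom_pr _ (hom_one (form_cdga m))) k0.
Defined.

Definition apl_add (f g : apl) : apl.
Proof.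
exists (fun m s => f m s + g m s).
  move=> k m a t s am ts.
  by rewrite (apl_formP f am ts) (apl_formP g am ts) linearD.
have [S fS] := apl_formB f; have [S' gS] := apl_formB g; exists (S ++ S').
move=> m s k; rewrite mem_cat negb_or => /andP[kS kS'].
by move: (fS m s k kS) (gS m s k kS'); rewrite linearD /= => -> ->; rewrite addr0.
Defined.

Definition apl_scale (c : rat) (f : apl) : apl.
Proof.
exists (fun m s => c *: f m s).
  by move=> k m a t s am ts; rewrite (apl_formP f am ts) linearZ.
have [S fS] := apl_formB f; exists S => m s k kS.
by move: (fS m s k kS); rewrite linearZ /= => ->; rewrite scaler0.
Defined.

Definition apl_opp (f : apl) : apl := apl_scale (-1) f.

Definition apl_pr (j : int) (f : apl) : apl.
Proof.
exists (fun m s => gr (form_cdga m) j (f m s)).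
  move=> k m a t s am ts.
  by rewrite (apl_formP f am ts) /pull -(feval_pr (pull_coordP a)).
exists [:: j] => m s k; rewrite inE => /negbTE kj.
by rewrite pr_pr kj.
Defined.

Definition apl_diff (f : apl) : apl.
Proof.
exists (fun m s => cdiff (f m s)).
  move=> k m a t s am ts.
  by rewrite (apl_formP f am ts) /pull -(feval_diff (pull_coordP a)).
have [S fS] := apl_formB f; exists [seq i + 1 | i <- S] => m s.
by apply: diff_support; apply: fS.
Defined.

Definition apl_mul (f g : apl) : apl.
Proof.
exists (fun m s => amul (f m s) (g m s)).
  move=> k m a t s am ts.
  by rewrite (apl_formP f am ts) (apl_formP g am ts) /pull -(feval_mul (pull_coordP a)).
have [S fS] := apl_formB f; have [S' gS] := apl_formB g.
exists [seq i + j | i <- S, j <- S'] => m s.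
by apply: mul_support; [apply: fS|apply: gS].
Defined.

Lemma apl_addA : associative apl_add.
Proof. by move=> f g h; apply: apl_ext => m s /=; rewrite addrA. Qed.
Lemma apl_addC : commutative apl_add.
Proof. by move=> f g; apply: apl_ext => m s /=; rewrite addrC. Qed.
Lemma apl_add0 : left_id apl_zero apl_add.
Proof. by move=> f; apply: apl_ext => m s /=; rewrite add0r. Qed.
Lemma apl_addN : left_inverse apl_zero apl_opp apl_add.
Proof. by move=> f; apply: apl_ext => m s /=; rewrite scaleN1r addNr. Qed.
HB.instance Definition _ :=
  GRing.isZmodule.Build apl apl_addA apl_addC apl_add0 apl_addN.

Lemma apl_scaleA a b f : apl_scale a (apl_scale b f) = apl_scale (a * b) f.
Proof. by apply: apl_ext => m s /=; rewrite scalerA. Qed.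
Lemma apl_scale1 : left_id 1 apl_scale.
Proof. by move=> f; apply: apl_ext => m s /=; rewrite scale1r. Qed.
Lemma apl_scaleDr : right_distributive apl_scale +%R.
Proof. by move=> a f g; apply: apl_ext => m s /=; rewrite scalerDr. Qed.
Lemma apl_scaleDl f : {morph apl_scale^~ f : a b / a + b}.
Proof. by move=> a b; apply: apl_ext => m s /=; rewrite scalerDl. Qed.
HB.instance Definition _ := GRing.Zmodule_isLmodule.Build rat apl
  apl_scaleA apl_scale1 apl_scaleDr apl_scaleDl.

Lemma apl_sumE I (r : seq I) (F : I -> apl) m (s : singular R X m) :
  (\sum_(i <- r) F i : apl) m s = \sum_(i <- r) F i m s.
Proof. by elim/big_rec2: _ => // i u v _ <-. Qed.

Lemma apl_pr_linear k : linear (apl_pr k).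
Proof. by move=> a f g; apply: apl_ext => m s; apply: fpr_linear. Qed.
Lemma apl_pr_pr k j f : apl_pr k (apl_pr j f) = if k == j then apl_pr j f else 0.
Proof. by apply: apl_ext => m s /=; rewrite fpr_pr; case: eqP. Qed.
Lemma apl_pr_sum f : exists2 S : seq int, uniq S & f = \sum_(k <- S) apl_pr k f.
Proof.
have [S fS] := apl_formB f; exists (undup S); first exact: undup_uniq.
apply: apl_ext => m s; rewrite apl_sumE.
apply: (grading_sum (G := gr (form_cdga m)) (undup_uniq S)) => k.
by rewrite mem_undup; apply: fS.
Qed.
Definition apl_grading : grading apl := Grading apl_pr_linear apl_pr_pr apl_pr_sum.

Lemma apl_hom k f : apl_grading k f = f -> forall m s, homog k (f m s).
Proof. by move=> fk m s; rewrite /homog -[in RHS]fk. Qed.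

Lemma apl_mul_linearl g : linear (fun f => apl_mul f g).
Proof. by move=> a f f'; apply: apl_ext => m s; apply: fmul_linearl. Qed.
Lemma apl_mul_linearr f : linear (apl_mul f).
Proof. by move=> a g g'; apply: apl_ext => m s; apply: fmul_linearr. Qed.
Lemma apl_mulA : associative apl_mul.
Proof. by move=> f g h; apply: apl_ext => m s /=; rewrite fmulA. Qed.
Lemma apl_mul_hom i j f g : apl_grading i f = f -> apl_grading j g = g ->
  apl_grading (i + j) (apl_mul f g) = apl_mul f g.
Proof.
by move=> fi gj; apply: apl_ext => m s; apply: mul_hom; apply: apl_hom.
Qed.
Lemma apl_mul_comm i j f g : apl_grading i f = f -> apl_grading j g = g ->
  apl_mul f g = ((-1) ^ (i * j) : rat) *: apl_mul g f.
Proof.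
by move=> fi gj; apply: apl_ext => m s; apply: mul_comm; apply: apl_hom.
Qed.
Lemma apl_diff_linear : linear apl_diff.
Proof. by move=> a f g; apply: apl_ext => m s; apply: fdiff_linear. Qed.
Lemma apl_diff_hom i f : apl_grading i f = f ->
  apl_grading (i + 1) (apl_diff f) = apl_diff f.
Proof. by move=> fi; apply: apl_ext => m s; apply: diff_hom; apply: apl_hom. Qed.
Lemma apl_diff_diff f : apl_diff (apl_diff f) = 0.
Proof. by apply: apl_ext => m s /=; apply: fdiff_diff. Qed.
Lemma apl_diff_mul i f g : apl_grading i f = f ->
  apl_diff (apl_mul f g) =
    apl_mul (apl_diff f) g + ((-1) ^ i : rat) *: apl_mul f (apl_diff g).
Proof. by move=> fi; apply: apl_ext => m s; apply: diff_mul; apply: apl_hom. Qed.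

Definition apl_nucdga : nucdga :=
  @NUCdga apl apl_grading apl_mul apl_diff apl_mul_linearl apl_mul_linearr
    apl_mulA apl_mul_hom apl_mul_comm apl_diff_linear apl_diff_hom
    apl_diff_diff apl_diff_mul.

Lemma apl_hom_one : homog 0 (apl_one : apl_nucdga).
Proof. by apply: apl_ext => m s; apply: (hom_one (form_cdga m)). Qed.
Lemma apl_mul1x : left_id apl_one apl_mul.
Proof. by move=> f; apply: apl_ext => m s /=; rewrite fmul1x. Qed.
Lemma apl_mulx1 : right_id apl_one apl_mul.
Proof. by move=> f; apply: apl_ext => m s /=; rewrite fmulx1. Qed.

Definition apl_cdga : cdga := @Cdga apl_nucdga apl_one apl_hom_one apl_mul1x apl_mulx1.

End APL.

Section APLMap.
Variables (R : realType) (X Y : topologicalType) (f : X -> Y).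
Variable f_cont : continuous f.

Lemma sing_comp_subproof m (s : singular R X m) :
  {within simplex m, continuous (f \o s)}.
Proof.
move=> x; apply: (@continuous_comp (subspace (@simplex R m)) X Y).
  exact: (@sing_cont _ _ _ s x).
exact: f_cont.
Qed.
Definition sing_comp m (s : singular R X m) : singular R Y m :=
  Singular (@sing_comp_subproof m s).

Definition apl_pull (u : apl_cdga R Y) : apl_cdga R X.
Proof.
exists (fun m s => (u : apl R Y) m (sing_comp s)).
  move=> k m a t s am ts; apply: (apl_formP u am) => p pk /=; congr f; exact: ts.
by have [S uS] := apl_formB u; exists S => *; apply: uS.
Defined.

Lemma apl_pull_linear : linear apl_pull.
Proof. by move=> a u v; apply: apl_ext. Qed.
Lemma apl_pull_pr k u :
  apl_pull (gr (apl_cdga R Y) k u) = gr (apl_cdga R X) k (apl_pull u).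
Proof. exact: apl_ext. Qed.
Lemma apl_pull_mul : {morph apl_pull : u v / amul u v}.
Proof. by move=> u v; apply: apl_ext. Qed.
Lemma apl_pull_one : apl_pull (aone _) = aone _.
Proof. exact: apl_ext. Qed.
Lemma apl_pull_diff : {morph apl_pull : u / cdiff u}.
Proof. by move=> u; apply: apl_ext. Qed.

Definition apl_map : cdga_mor (apl_cdga R Y) (apl_cdga R X) :=
  CdgaMor apl_pull_linear apl_pull_pr apl_pull_mul apl_pull_one apl_pull_diff.

End APLMap.

(* Real vector bundles of rank n with oriented fibres, given by a trivialising
   atlas.  The vector space structure of the fibres is that of R^n in any chart;
   [reversing i] says that chart i reverses the orientation of the fibres (this
   is how both orientations are available when n = 0). *)
Record oriented_bundle (R : realType) (B : topologicalType) (n : nat) :=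
  OrientedBundle {
    total_space :> topologicalType;
    bproj : total_space -> B;
    proj_cont : continuous bproj;
    chart : Type;
    bdom : chart -> set B;
    dom_open : forall i, open (bdom i);
    dom_cover : forall b, exists i, bdom i b;
    triv : chart -> B * 'rV[R]_n -> total_space;
    reversing : chart -> bool;
    bcoord : chart -> total_space -> 'rV[R]_n;
    triv_cont : forall i, {within bdom i `*` setT, continuous (triv i)};
    coord_cont : forall i, {within bproj @^-1` bdom i, continuous (bcoord i)};
    proj_triv : forall i b v, bdom i b -> bproj (triv i (b, v)) = b;
    trivK : forall i b v, bdom i b -> bcoord i (triv i (b, v)) = v;
    coordK : forall i x, bdom i (bproj x) -> triv i (bproj x, bcoord i x) = x;
    transition : forall i j b, bdom i b -> bdom j b ->
      exists2 g : 'M[R]_n,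
        0 < (-1) ^+ (reversing i (+) reversing j) * \det g &
        forall v, bcoord j (triv i (b, v)) = v *m g
  }.

(* The integral over the standard n-simplex, oriented by dt_1 ... dt_n:
     \int t_1^a_1 ... t_n^a_n dt_1 ... dt_n = a_1! ... a_n! / (a_1 + ... + a_n + n)!
   These monomials form a basis of the polynomial n-forms on the n-simplex. *)
Definition monomial_form (n : nat) (a : {ffun 'I_n -> nat}) : form_cdga n :=
  let t i := tcoord (lift ord0 i) in
  amul (\big[@amul (form_cdga n)/aone (form_cdga n)]_(i < n)
         iter (a i) (amul (t i)) (aone (form_cdga n)))
      (\big[@amul (form_cdga n)/aone (form_cdga n)]_(i < n) cdiff (t i)).

Definition monomial_integral (n : nat) (a : {ffun 'I_n -> nat}) : rat :=
  (\prod_i (a i)`!)%:R / ((\sum_i a i + n)`!)%:R.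

Definition has_integral (n : nat) (x : form_cdga n) (c : rat) : Prop :=
  exists l : seq (rat * {ffun 'I_n -> nat}),
    x = \sum_(u <- l) u.1 *: monomial_form u.2 /\
    c = \sum_(u <- l) u.1 * monomial_integral u.2.

Section EulerClass.
Variables (R : realType) (B : topologicalType) (n : nat).
Variable xi : oriented_bundle R B n.

Definition nonzero_vectors : set xi :=
  [set x | exists2 i, bdom i (bproj x) & bcoord i x != 0].

(* Row j of V is the j-th vertex of an affine n-simplex in R^n, which is
   positively oriented and has 0 in its interior: it represents the preferred
   generator of H_n(R^n, R^n - 0). *)
Definition orientation_simplex (V : 'M[R]_(n.+1, n)) : Prop :=
  0 < \det (\matrix_(i, j) (V (lift ord0 i) j - V ord0 j)) /\
  exists2 s : 'rV[R]_n.+1, simplex n s & (forall i, 0 < s 0 i) /\ s *m V = 0.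

(* Closed n-forms on the total space, relative to the nonzero vectors, whose
   class restricts on each fibre to the orientation class. *)
Definition thom_form (u : cocycle (apl_cdga R xi)) : Prop :=
  [/\ homog n%:Z (u : apl_cdga R xi),
      forall m (s : singular R xi m),
        (forall p, simplex m p -> nonzero_vectors (s p)) ->
        (cval u : apl R xi) m s = 0
    & forall i b (V : 'M[R]_(n.+1, n)) (s : singular R xi n),
        bdom i b -> orientation_simplex V ->
        (forall p, simplex n p -> s p = triv i (b, p *m V)) ->
        has_integral ((cval u : apl R xi) n s) ((-1) ^+ reversing i)].

(* The Euler class is the class of H^n(B) that the projection pulls back to
   the image of the Thom class in H^n(E). *)
Definition is_euler_class (c : cohomology (apl_cdga R B)) : Prop :=
  exists2 u, thom_form u & hmor (apl_map R (@proj_cont _ _ _ xi)) c = cls u.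

End EulerClass.

(* Main.v *)
Require Import Defs.
From mathcomp Require Import all_boot all_order all_algebra.
From mathcomp Require Import zify.
From mathcomp Require Import boolp classical_sets functions reals topology.
Set Implicit Arguments.
Unset Strict Implicit.
Unset Printing Implicit Defensive.
Import GRing.Theory.
Local Open Scope classical_set_scope.
Local Open Scope ring_scope.

(** In A[e] the product is w_a w_b = w_(eab), and e, having even degree, commutes with everything
    without a sign. Hence all three Massey products range over the same cochains l, m with dl = exy
    and dm = eyz. Both (ex, y, ez) and (w_x, w_y, w_z) yield the cocycle (-1)^p exm - elz, which is
    e times the cocycle (-1)^p xm - lz of (x, ey, z). [cup_euler_massey] and [thom_massey] make
    these two comparisons; injectivity and additivity at 0 of [thom_iso] give the rest. *)

Lemma thom_iso_bij (A : cdga) (n : nat) (n_even : ~~ odd n) (e : cocycle A)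
    (e_n : homog n%:Z (e : A)) :
  bijective (thom_iso n_even e_n).
Proof.
(* A[e] and A share total space and differential, so a cocycle of one is a cocycle of the other. *)
pose unw (v : cocycle (thom_cdga n_even e_n)) : cocycle A :=
  @Cocycle A (v : A) (cvalP v).
exists (fun h => cls (unw (rep h))) => h.
  rewrite -[h in RHS]rep_K /thom_iso; apply/cls_eq.
  by have [u uP] := rep_cls (wc n_even e_n (rep h)); exists u.
rewrite thom_isoE -[h in RHS]rep_K; congr cls; exact: val_inj.
Qed.

Lemma thom_iso0 (A : cdga) (n : nat) (n_even : ~~ odd n) (e : cocycle A)
    (e_n : homog n%:Z (e : A)) :
  thom_iso n_even e_n 0 = 0.
Proof.
have cls0 (A' : nucdga) : cls (0 : cocycle A') = 0.
  exact: pi_zeror.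
rewrite -[in LHS]cls0 thom_isoE -cls0; congr cls; exact: val_inj.
Qed.

(** Both terms have differential abc: the Leibniz sign (-1)^p cancels the one in front of am. This
    supplies the cocycle when only l and m are known. *)
Lemma massey_cochain_cocycle (A : nucdga) (p : int) (a b c : cocycle A)
    (l m : A) :
  homog p (a : A) -> cdiff l = amul (a : A) b -> cdiff m = amul (b : A) c ->
  cdiff (((-1) ^ p : rat) *: amul (a : A) m - amul l (c : A)) = 0.
Proof.
move=> a_p dl dm.
rewrite linearB linearZ /= (diff_mul _ a_p) diff_cocycle mul0x add0r.
rewrite diff_mul_cocycle dl dm scalerA -expfzMl mulrNN mulr1 exp1rz scale1r.
by rewrite Defs.mulA subrr.
Qed.

Section EulerMassey.
Variables (A : cdga) (n : nat) (n_even : ~~ odd n) (e : cocycle A).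
Hypothesis e_n : homog n%:Z (e : A).
Variables (p q r : int) (x y z : cocycle A).

Let exC (u : A) : amul (e : A) u = amul u e := mul_ex n_even e_n u.

Let signD_n (i : int) : ((-1) ^ (i + n%:Z) : rat) = (-1) ^ i.
Proof.
have u1 : (-1 : rat) \is a GRing.unit by rewrite unitrN1.
by rewrite expfzDr // -[n%:Z]mulr1 sign_n // mulr1.
Qed.

(* The three Massey products are all given by cochains l, m with dl = exy and
   dm = eyz, and by the cocycles (-1)^p exm - elz. *)
Lemma cup_euler_massey : homog p (x : A) ->
  [set hmul (cls e) s | s in massey p (n%:Z + q) r x (cmul e y) z] =
  massey (n%:Z + p) q (n%:Z + r) (cmul e x) y (cmul e z).
Proof.
move=> x_p.
have deg_l : p + (n%:Z + q) - 1 = n%:Z + p + q - 1 by lia.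
have deg_m : n%:Z + q + r - 1 = q + (n%:Z + r) - 1 by lia.
have dlE : amul (x : A) (cmul e y) = amul (cmul e x : A) y.
  by rewrite /= Defs.mulA -exC.
have dmE : amul (cmul e y : A) z = amul (y : A) (cmul e z).
  by rewrite /= Defs.mulA -exC.
have vE (l m : A) :
    amul (e : A) (((-1) ^ p : rat) *: amul (x : A) m - amul l (z : A)) =
    ((-1) ^ (n%:Z + p) : rat) *: amul (cmul e x : A) m - amul l (cmul e z : A).
  rewrite linearB linearZ /= [n%:Z + p]addrC signD_n !Defs.mulA.
  by rewrite [amul (e : A) l]exC.
apply/seteqP; split=> h.
  move=> [_ [l [m [v [[l_deg dl] [m_deg dm] vP ->]]]] <-].
  exists l, m, (cmul e v); split; last exact: hmulE.
  - by rewrite -deg_l dl dlE.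
  - by rewrite -deg_m dm dmE.
  - by rewrite /= vP vE.
move=> [l [m [v [[l_deg dl] [m_deg dm] vP ->]]]].
rewrite -dlE in dl; rewrite -dmE in dm.
(* The given v is only the e-multiple; the factor (-1)^p xm - lz, built from the same l and m, must
   itself be shown closed. *)
have v'P := massey_cochain_cocycle x_p dl dm.
pose v' : cocycle A := Cocycle (introT eqP v'P).
exists (cls v').
  exists l, m, v'; split=> //; first by rewrite deg_l.
  by rewrite deg_m.
rewrite hmulE; congr cls; apply: val_inj; rewrite /= vE; exact/esym.
Qed.

(** The defining systems coincide: degrees in A[e] exceed those in A by n, once for each single
    cochain, and the sign (-1)^(p + n) is the same on both sides. *)
Lemma thom_massey :
  [set thom_iso n_even e_n h |
    h in massey (n%:Z + p) q (n%:Z + r) (cmul e x) y (cmul e z)] =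
  massey (p + n%:Z) (q + n%:Z) (r + n%:Z)
    (wc n_even e_n x) (wc n_even e_n y) (wc n_even e_n z).
Proof.
have deg_l : p + n%:Z + (q + n%:Z) - 1 - n%:Z = n%:Z + p + q - 1 by lia.
have deg_m : q + n%:Z + (r + n%:Z) - 1 - n%:Z = q + (n%:Z + r) - 1 by lia.
have dmE : amul (y : A) (cmul e z) = thom_mul e (y : A) z.
  by rewrite /thom_mul /= Defs.mulA -exC.
have vE (l m : A) :
    ((-1) ^ (n%:Z + p) : rat) *: amul (cmul e x : A) m - amul l (cmul e z : A) =
    ((-1) ^ (p + n%:Z) : rat) *: thom_mul e (x : A) m - thom_mul e l z.
  by rewrite [n%:Z + p]addrC /thom_mul [amul (e : A) l]exC /= Defs.mulA.
apply/seteqP; split=> h.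
  move=> [_ [l [m [v [[l_deg dl] [m_deg dm] vP ->]]]] <-].
  exists l, m, (wc n_even e_n v); split; last exact: thom_isoE.
  - by split; [rewrite /homog /= deg_l|].
  - by split; [rewrite /homog /= deg_m|rewrite /= -dmE].
  - exact: etrans vP (vE l m).
move=> [l [m [v [[l_deg dl] [m_deg dm] vP ->]]]].
pose v' : cocycle A := @Cocycle A (v : A) (cvalP v).
exists (cls v').
  exists l, m, v'; split=> //.
  - by split; [rewrite /homog -deg_l|].
  - by split; [rewrite /homog -deg_m|rewrite dmE].
  - exact: etrans vP (esym (vE l m)).
rewrite thom_isoE; congr cls; exact: val_inj.
Qed.

End EulerMassey.

Theorem lemma3p10 (R : realType) (B : topologicalType) (n : nat)
    (n_even : ~~ odd n) (xi : oriented_bundle R B n)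
    (A : cdga) (model : quasi_iso_string A (apl_cdga R B))
    (e : cocycle A) (e_n : homog n%:Z (e : A))
    (e_euler : is_euler_class xi (string_iso model (cls e)))
    (p q r : int) (x y z : cocycle A)
    (x_p : homog p (x : A)) (y_q : homog q (y : A)) (z_r : homog r (z : A)) :
  massey_defined (wc n_even e_n x) (wc n_even e_n y) (wc n_even e_n z) ->
  let e_massey := [set hmul (cls e) s | s in
    massey p (n%:Z + q) r x (cmul e y) z] in
  let w_massey := massey (p + n%:Z) (q + n%:Z) (r + n%:Z)
    (wc n_even e_n x) (wc n_even e_n y) (wc n_even e_n z) in
  [/\ e_massey = massey (n%:Z + p) q (n%:Z + r) (cmul e x) y (cmul e z),
      set_bij e_massey w_massey (thom_iso n_even e_n),
      thom_iso n_even e_n 0 = 0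
    & e_massey 0 <-> w_massey 0].
Proof.
move=> _ e_massey w_massey.
have e_masseyE : e_massey = _ := cup_euler_massey n_even e_n q r y z x_p.
have w_masseyE : [set thom_iso n_even e_n h | h in e_massey] = w_massey.
  by rewrite e_masseyE; apply: thom_massey.
have thom_inj := bij_inj (thom_iso_bij n_even e_n).
split=> //.
(* The target is the image of the source, so only injectivity is left. *)
- rewrite -w_masseyE; split=> //.
  by move=> h k _ _ /thom_inj.
- exact: thom_iso0.
- rewrite -w_masseyE -[in X in _ <-> X](thom_iso0 n_even e_n).
  split=> [h0|[h hP /thom_inj <-] //]; first by exists 0.
Qed.
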